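(* Let $m\ge 4$ be even, $n=2^m-1$, and let $i_1\neq i_2$ in $\{0,1,2,3\}$ be such that the extended code $\mathcal{C}^*_{i_1,i_2}$ of $\mathcal{C}_{i_1,i_2}$ is an $[n+1,n-m-1,4]$ code of length $n+1=2^m$. Then $\mathcal{C}^*_{i_1,i_2}$ is completely transitive with covering radius $\rho=4$ and intersection array $\bigl(n+1,n,\tfrac{n+1}{2},1;\,1,\tfrac{n+1}{2},n,n+1\bigr)$ if and only if $0\notin\{i_1,i_2\}$.
   Context: $\mathbb{F}_2$ is the binary field. Let $\alpha$ be a primitive element of $GF(2^m)$ and let $H_m$ be the $m\times n$ binary matrix whose $i$-th column $\mathbf{h}_i$ ($i=0,\dots,n-1$) is the coordinate vector of $\alpha^i$ with respect to the basis $1,\alpha,\dots,\alpha^{m-1}$ (so the columns are exactly the nonzero vectors of $\mathbb{F}_2^m$; $H_m$ is a parity check matrix of the Hamming code). For distinct $i_1,i_2\in\{0,1,2,3\}$, $\mathbf{v}_{i_1,i_2}=(v_0,\dots,v_{n-1})$ has $v_i=1$ iff the Hamming weight $\mathrm{wt}(\mathbf{h}_i)\equiv i_1$ or $i_2\pmod 4$; $\mathcal{C}_{i_1,i_2}$ is the code with parity check matrix $H_m$ with the row $\mathbf{v}_{i_1,i_2}$ appended. The extension of a code $C$ of length $n$ is $C^*=\{(c_\infty,c_0,\dots,c_{n-1}):(c_0,\dots,c_{n-1})\in C,\ c_\infty=\sum_i c_i\}$. For a binary linear code $C$ of length $N$: $d(\mathbf{v},C)$ is the minimum Hamming distance from $\mathbf{v}$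 to $C$, the covering radius is $\rho=\max_{\mathbf{v}}d(\mathbf{v},C)$, and $C(l)=\{\mathbf{x}:d(\mathbf{x},C)=l\}$. $C$ is completely regular if for each $l$ every $\mathbf{x}\in C(l)$ has the same number $c_l$ of neighbors (vectors at distance 1) in $C(l-1)$ and the same number $b_l$ in $C(l+1)$; the intersection array is $(b_0,\dots,b_{\rho-1};c_1,\dots,c_\rho)$. $\mathrm{Aut}(C)$ is the group of coordinate permutations preserving $C$, acting on cosets via $\pi(C+\mathbf{v})=C+\pi(\mathbf{v})$; $C$ is completely transitive if $\mathrm{Aut}(C)$ has exactly $\rho+1$ orbits on the cosets of $C$. *)

(* Defs.v *)
From HB Require Import structures.
From mathcomp Require Import all_boot all_order all_algebra all_fingroup all_field.

Set Implicit Arguments.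
Unset Strict Implicit.
Unset Printing Implicit Defensive.

Import GRing.Theory.
Local Open Scope ring_scope.

Section Codes.
Variable N : nat.
Implicit Types (x y : 'rV['F_2]_N) (C : {vspace 'rV['F_2]_N}).

Definition wt x : nat := #|[set i | x 0 i != 0]|.

Definition hdist x y : nat := #|[set i | x 0 i != y 0 i]|.

(* All distances are at most N and C is nonempty, so the default value N
   does not affect the minimum. *)
Definition dist_code x C : nat := \big[minn/N]_(c | c \in C) hdist x c.

Definition covering_radius C : nat := \max_x dist_code x C.

Definition is_min_dist C (d : nat) : Prop :=
  (exists x y, [/\ x \in C, y \in C, x != y & hdist x y = d]) /\
  (forall x y, x \in C -> y \in C -> x != y -> (d <= hdist x y)%N).

(* C is an [N, k, d] code. *)
Definition code_params C (k d : nat) : Prop := \dim C = k /\ is_min_dist C d.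

(* Neighbors of x in C(l - 1), resp. in C(l + 1), where x belongs to C(l);
   C(-1) is empty. *)
Definition lower_nbrs C x : {set 'rV['F_2]_N} :=
  [set y | (hdist x y == 1%N) && ((dist_code y C).+1 == dist_code x C)].

Definition upper_nbrs C x : {set 'rV['F_2]_N} :=
  [set y | (hdist x y == 1%N) && (dist_code y C == (dist_code x C).+1)].

Definition completely_regular_with C (b c : nat -> nat) : Prop :=
  forall x, #|upper_nbrs C x| = b (dist_code x C) /\
            #|lower_nbrs C x| = c (dist_code x C).

Definition completely_regular C : Prop :=
  exists b c : nat -> nat, completely_regular_with C b c.

(* bs = (b_0, ..., b_(rho - 1)) and cs = (c_1, ..., c_rho). *)
Definition is_intersection_array C (bs cs : seq nat) : Prop :=
  exists b c : nat -> nat,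
    [/\ completely_regular_with C b c,
        bs = map b (iota 0 (covering_radius C))
      & cs = map c (iota 1 (covering_radius C))].

(* pi(v)_(pi i) = v_i; the inverse makes this a right action. *)
Definition perm_word x (s : 'S_N) : 'rV['F_2]_N := col_perm s^-1%g x.

Fact perm_word1 : perm_word^~ 1%g =1 id.
Proof. by move=> x; rewrite /perm_word invg1 col_perm1. Qed.

Fact perm_wordM : forall x, act_morph perm_word x.
Proof. by move=> x s t; rewrite /perm_word invMg col_permM. Qed.

Canonical perm_word_action := TotalAction perm_word1 perm_wordM.

Definition code_aut C : {set 'S_N} := 'N([set x in C] | perm_word_action)%g.

Definition code_coset C x : {set 'rV['F_2]_N} := [set x + c | c in C].

(* Since Aut(C) preserves C, it maps the coset C + v, as a set, to C + pi(v). *)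
Definition coset_orbits C : {set {set {set 'rV['F_2]_N}}} :=
  [set orbit (perm_word_action^*)%act (code_aut C) (code_coset C x)
     | x : 'rV['F_2]_N].

Definition completely_transitive C : Prop :=
  #|coset_orbits C| = (covering_radius C).+1.

Definition parity_check_code k (P : 'M['F_2]_(k, N)) : {vspace 'rV['F_2]_N} :=
  lker (linfun (mulmxr P^T : 'rV_N -> 'rV_k)).

Lemma mem_parity_check_code k (P : 'M['F_2]_(k, N)) x :
  (x \in parity_check_code P) = (P *m x^T == 0).
Proof.
by rewrite memv_ker lfunE /= -(inj_eq (@trmx_inj _ _ _)) trmx_mul trmxK trmx0.
Qed.

(* The coordinate at infinity comes first, at index 0. *)
Definition extend_word x : 'rV['F_2]_(1 + N) := row_mx (\sum_i x 0 i)%:M x.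

Fact extend_word_is_linear : linear extend_word.
Proof.
move=> a x y; rewrite /extend_word scale_row_mx add_row_mx; congr row_mx.
apply/matrixP=> i j; rewrite !ord1 !mxE !mulr1n big_distrr -big_split /=.
by apply: eq_bigr => l _; rewrite !mxE.
Qed.

HB.instance Definition _ :=
  GRing.isLinear.Build 'F_2 'rV['F_2]_N 'rV['F_2]_(1 + N) *:%R extend_word
    extend_word_is_linear.

Definition extension C : {vspace 'rV['F_2]_(1 + N)} :=
  (linfun extend_word @: C)%VS.

Lemma mem_extensionP C (z : 'rV['F_2]_(1 + N)) :
  reflect (exists2 x, x \in C & z = extend_word x) (z \in extension C).
Proof.
apply: (iffP memv_imgP) => -[x xC ->]; exists x => //; by rewrite lfunE.
Qed.

End Codes.

Section HammingSubcodes.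
Variables (L : fieldExtType 'F_2) (alpha : L) (m n : nat) (i1 i2 : 'I_4).

Definition power_basis : m.-tuple L := [tuple alpha ^+ i | i < m].

Definition hamming_mx : 'M['F_2]_(m, n) :=
  \matrix_(i < m, j < n) coord power_basis i (alpha ^+ j).

Definition weight_row : 'rV['F_2]_n :=
  \row_j (let w := wt (col j hamming_mx)^T in
          (w == i1 %[mod 4]) || (w == i2 %[mod 4]))%:R.

Definition code_i1i2 : {vspace 'rV['F_2]_n} :=
  parity_check_code (col_mx hamming_mx weight_row).

End HammingSubcodes.

(* Main.v *)
Require Import Defs.
From HB Require Import structures.
From mathcomp Require Import all_boot all_order all_algebra all_fingroup all_field.
From mathcomp Require Import zify.

Set Implicit Arguments.
Unset Strict Implicit.
Unset Printing Implicit Defensive.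

Import GRing.Theory.
Local Open Scope ring_scope.

(** Index the coordinates of the extended code by the vectors v of F_2^m, the
coordinate at infinity being v = 0. A word x is in the code iff its syndrome,
the sum of x_v (1, v, f v), vanishes, where f v tells whether v <> 0 and wt v is
i1 or i2 mod 4.

Modulo 4, wt (u + v) = wt u + wt v - 2 |u /\ v|, so that the indicator of
weights i1, i2 mod 4 is, up to a constant, a quadratic form q. Its polar form
is 0 if i1 and i2 have the same parity, and otherwise has matrix J - I, which is
nondegenerate because m is even.

If 0 is not in {i1, i2} then f = q; the case {1, 3} is excluded by the
dimension, so f is bent. The distance of a word to the code can then be read off
its syndrome (a, s, t), and so can the intersection numbers. Translations of
F_2^m and symplectic transvections change f by affine functions, hence are
automorphisms; they are transitive on the cosets at each given distance.

If 0 is in {i1, i2} then f = q + [v <> 0]. A word supported on 0 and s is at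
distance 2 from the code and has 2 or 2^(m-1) + 2 neighbors at distance 1,
instead of the 2^(m-1) prescribed by the intersection array. *)

(** * Arithmetic over the binary field *)

Lemma F2P (a : 'F_2) : a = 0 \/ a = 1.
Proof. by case: a => [[|[|k]] lt_k] //; [left | right]; apply: val_inj. Qed.

Lemma F2_neq1 (a : 'F_2) : (a != 1) = (a == 0).
Proof. by case: (F2P a) => ->. Qed.

Lemma F2_addrr (a : 'F_2) : a + a = 0.
Proof. by case: (F2P a) => ->; apply/eqP. Qed.

Lemma F2_addr_eq0 (a b : 'F_2) : (a + b == 0) = (a == b).
Proof. by case: (F2P a) => ->; case: (F2P b) => ->. Qed.

Lemma F2_mxaddrr (p q : nat) (A : 'M['F_2]_(p, q)) : A + A = 0.
Proof. by apply/matrixP=> i j; rewrite !mxE F2_addrr. Qed.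

Lemma F2_mxoppr (p q : nat) (A : 'M['F_2]_(p, q)) : - A = A.
Proof. by apply/eqP; rewrite eq_sym -addr_eq0 F2_mxaddrr. Qed.

Lemma F2_mxaddr_eq0 (p q : nat) (A B : 'M['F_2]_(p, q)) : (A + B == 0) = (A == B).
Proof. by rewrite addr_eq0 F2_mxoppr. Qed.

Lemma F2_mxaddKr (p q : nat) (A B : 'M['F_2]_(p, q)) : A + (A + B) = B.
Proof. by rewrite addrA F2_mxaddrr add0r. Qed.

(** * Hamming distance and distance to a code *)

Section Distance.
Variable N : nat.
Implicit Types (x y z : 'rV['F_2]_N) (C : {vspace 'rV['F_2]_N}) (k : 'I_N).

Local Notation unit_word k := (delta_mx 0 k : 'rV['F_2]_N).

Lemma hdist_wt x y : hdist x y = wt (x + y).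
Proof. by apply: eq_card => i; rewrite !inE mxE F2_addr_eq0. Qed.

Lemma hdist_leN x y : (hdist x y <= N)%N.
Proof. by rewrite -[leqRHS]card_ord max_card. Qed.

Lemma wt0 : wt (0 : 'rV['F_2]_N) = 0%N.
Proof. by apply: eq_card0 => i; rewrite !inE mxE eqxx. Qed.

Lemma wt_eq0 x : (wt x == 0%N) = (x == 0).
Proof.
apply/eqP/eqP => [/eqP|->]; last exact: wt0.
rewrite cards_eq0 => /eqP x0; apply/rowP=> i.
have: i \notin [set i | x 0 i != 0] by rewrite x0 inE.
by rewrite inE negbK mxE => /eqP.
Qed.

Lemma wt_add_unit x k :
  wt (x + unit_word k) = if x 0 k == 0 then (wt x).+1 else (wt x).-1.
Proof.
case: ifP => xk.
  have -> : wt (x + unit_word k) = #|k |: [set i | x 0 i != 0]|.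
    apply: eq_card => i; rewrite !inE !mxE eqxx /=.
    by have [->|_] := eqVneq i k; rewrite ?(eqP xk) ?addr0.
  by rewrite cardsU1 inE xk.
have -> : wt (x + unit_word k) = #|[set i | x 0 i != 0] :\ k|.
  apply: eq_card => i; rewrite !inE !mxE eqxx /=.
  have [->|_] := eqVneq i k; last by rewrite addr0.
  by case: (F2P (x 0 k)) xk => ->.
by rewrite [in RHS]/wt [in RHS](cardsD1 k) inE xk.
Qed.

Lemma wt_unit k : wt (unit_word k) = 1%N.
Proof. by rewrite -[unit_word k]add0r wt_add_unit mxE eqxx wt0. Qed.

Lemma wt_eq1P x : reflect (exists k, x = unit_word k) (wt x == 1%N).
Proof.
apply: (iffP idP) => [/cards1P[k xk]|[k ->]]; last by rewrite wt_unit.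
exists k; apply/rowP=> i; rewrite mxE eqxx /=.
have := in_set1 i k; rewrite -xk inE eq_sym.
by case: (F2P (x 0 i)) => -> /=; case: eqVneq.
Qed.

Lemma hdist_eq1P x y :
  reflect (exists k, y = x + unit_word k) (hdist x y == 1%N).
Proof.
rewrite hdist_wt; apply: (iffP (wt_eq1P _)) => -[k e]; exists k.
  by rewrite -e F2_mxaddKr.
by rewrite e F2_mxaddKr.
Qed.

Lemma card_neighbors x (P : pred 'rV['F_2]_N) :
  #|[set y | (hdist x y == 1%N) && P y]| = #|[set k | P (x + unit_word k)]|.
Proof.
rewrite -(card_imset _ (_ : injective (fun k => x + unit_word k))).
  apply: eq_card => y; rewrite !inE; apply/andP/imsetP => [[/hdist_eq1P[k ->] Pk]|].
    by exists k; rewrite ?inE.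
  by case=> k; rewrite inE => Pk ->; split=> //; apply/hdist_eq1P; exists k.
move=> i j /addrI/rowP/(_ i); rewrite !mxE !eqxx /=.
by case: eqVneq.
Qed.

Lemma dist_code_le C x c : c \in C -> (dist_code x C <= hdist x c)%N.
Proof.
move=> cC; rewrite /dist_code; elim: (index_enum _) (mem_index_enum c) => //= d r IHr.
rewrite inE big_cons => /predU1P[<-|/IHr le_r]; first by rewrite cC geq_minl.
by case: ifP => // _; rewrite geq_min le_r orbT.
Qed.

Lemma dist_code_attained C x : exists2 c, c \in C & dist_code x C = hdist x c.
Proof.
have: dist_code x C = N \/ exists2 c, c \in C & dist_code x C = hdist x c.
  rewrite /dist_code.
  elim/big_ind: _ => [|u v Pu Pv|c cC]; [by left| |by right; exists c].
  by case: (leqP u v) => _.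
(* If the minimum is the default [N], the codeword 0 attains it, since no distance exceeds [N]. *)
case=> // dN; exists 0; first exact: mem0v.
by apply/eqP; rewrite eqn_leq dist_code_le ?mem0v //= dN hdist_leN.
Qed.

Lemma dist_code_leP C x l :
  reflect (exists2 c, c \in C & (hdist x c <= l)%N) (dist_code x C <= l)%N.
Proof.
apply: (iffP idP) => [|[c cC]]; last by apply: leq_trans; apply: dist_code_le.
by have [c cC ->] := dist_code_attained C x; exists c.
Qed.

Lemma dist_code_coset C x c : c \in C -> dist_code (x + c) C = dist_code x C.
Proof.
have le d y : d \in C -> (dist_code (y + d) C <= dist_code y C)%N.
  move=> dC; have [e eC ->] := dist_code_attained C y.
  apply/dist_code_leP; exists (e + d); first exact: memvD.
  by rewrite !hdist_wt addrACA F2_mxaddrr addr0.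
move=> cC; apply/eqP; rewrite eqn_leq le //=.
by rewrite -{1}[x](addrK c) F2_mxoppr le.
Qed.

Lemma dist_code_lipschitz C x k :
  (dist_code x C <= (dist_code (x + unit_word k) C).+1)%N.
Proof.
have [c cC ->] := dist_code_attained C (x + unit_word k).
apply/dist_code_leP; exists c => //.
rewrite !hdist_wt addrAC wt_add_unit; case: ifP => _; first by rewrite ltnW.
by case: (wt _) => // w; rewrite /= ?leqnn.
Qed.

(* A function on words that vanishes exactly on C, changes by at most one
   along an edge of the Hamming graph, and decreases along some edge wherever
   it is positive, is the distance to C. *)
Lemma dist_codeE C (d : 'rV['F_2]_N -> nat) :
    (forall x, (d x == 0%N) = (x \in C)) ->
    (forall x k, (d x <= (d (x + unit_word k)%R).+1)%N) ->
    (forall x, (0 < d x)%N -> exists k, d x = (d (x + unit_word k)).+1) ->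
  forall x, dist_code x C = d x.
Proof.
move=> d0 dlip ddesc x; apply/eqP; rewrite eqn_leq; apply/andP; split.
  have [l] := ubnP (d x); elim: l x => // l IHl x; rewrite ltnS => dl.
  have [dx0|/ddesc[k dk]] := posnP (d x).
    by apply/dist_code_leP; exists x; rewrite -?d0 ?dx0 ?hdist_wt ?F2_mxaddrr ?wt0.
  apply: leq_trans (dist_code_lipschitz C x k) _.
  by rewrite dk ltnS IHl // -ltnS -dk.
(* Lower bound: walk from [x] to a nearest codeword, where [d] vanishes; each flipped coordinate
   lowers [d] by at most one. *)
have [c cC ->] := dist_code_attained C x.
have: d c = 0%N by apply/eqP; rewrite d0.
rewrite -{1}[c](F2_mxaddKr x) hdist_wt; have [l] := ubnP (wt (x + c)).
move: (x + c) => z; elim: l x z => // l IHl x z; rewrite ltnS => zl.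
have [/eqP|zpos dxz] := posnP (wt z).
  by rewrite wt_eq0 => /eqP->; rewrite addr0 => ->.
have /card_gt0P[k] := zpos; rewrite inE => zk.
have wz : wt (z + unit_word k) = (wt z).-1 by rewrite wt_add_unit (negPf zk).
apply: leq_trans (dlip x k) _; rewrite -(prednK zpos) ltnS -wz.
apply: IHl; first by rewrite wz prednK.
by rewrite addrACA F2_mxaddrr addr0.
Qed.

(** * Coordinate permutations, cosets and their orbits *)

Lemma perm_word_add x y s : perm_word (x + y) s = perm_word x s + perm_word y s.
Proof. by apply/rowP=> i; rewrite !mxE. Qed.

Lemma wt_perm_word x (s : 'S_N) : wt (perm_word x s) = wt x.
Proof.
rewrite /wt -[RHS](card_imset _ (@perm_inj _ s)); apply: eq_card => i.
rewrite inE mxE; apply/idP/imsetP => [xi|[j]].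
  by exists (s^-1%g i); rewrite ?inE ?permKV.
by rewrite inE => xj ->; rewrite permK.
Qed.

Lemma code_autP C (s : 'S_N) :
  reflect (forall x, (perm_word x s \in C) = (x \in C)) (s \in code_aut C).
Proof.
apply: (iffP idP) => [sC x|sC].
  have := astabs_act x sC; by rewrite !inE.
rewrite !inE /=; apply/subsetP=> x; rewrite !inE /= => xC.
by rewrite sC.
Qed.

(** One inclusion suffices: the code is finite and the permutation acts injectively. *)
Lemma stable_code_aut C (s : 'S_N) :
  (forall x, x \in C -> perm_word x s \in C) -> s \in code_aut C.
Proof. by move=> sC; rewrite !inE; apply/subsetP=> x; rewrite !inE; apply: sC. Qed.

Lemma dist_code_perm C x (s : 'S_N) :
  s \in code_aut C -> dist_code (perm_word x s) C = dist_code x C.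
Proof.
have le t y : t \in code_aut C -> (dist_code (perm_word y t) C <= dist_code y C)%N.
  move=> /code_autP tC; have [c cC ->] := dist_code_attained C y.
  apply/dist_code_leP; exists (perm_word c t); first by rewrite tC.
  by rewrite !hdist_wt -perm_word_add wt_perm_word.
move=> sC; apply/eqP; rewrite eqn_leq le //=.
by rewrite -{1}[x](actK (perm_word_action N) s) /= le // groupV.
Qed.

Lemma mem_code_coset C x y : (y \in code_coset C x) = (x + y \in C).
Proof.
apply/imsetP/idP => [[c cC ->]|xyC]; first by rewrite F2_mxaddKr.
by exists (x + y) => //; rewrite F2_mxaddKr.
Qed.

Lemma code_coset_eqP C x y :
  reflect (code_coset C x = code_coset C y) (x + y \in C).
Proof.
apply: (iffP idP) => [xyC|e]; last first.
  by rewrite -mem_code_coset e mem_code_coset F2_mxaddrr mem0v.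
apply/setP=> z; rewrite !mem_code_coset.
suff -> : y + z = x + z + (x + y) by rewrite [RHS]rpredDr.
by rewrite addrACA F2_mxaddrr add0r addrC.
Qed.

Definition coset_orbit C x :=
  orbit ((perm_word_action N)^*)%act (code_aut C) (code_coset C x).

Lemma coset_orbit_perm C x (s : 'S_N) :
  s \in code_aut C -> coset_orbit C (perm_word x s) = coset_orbit C x.
Proof.
move=> sC; rewrite /coset_orbit.
suff -> : code_coset C (perm_word x s)
    = (((perm_word_action N)^*)%act (code_coset C x) s) by apply: orbit_act.
apply/setP=> y; rewrite mem_code_coset; apply/idP/imsetP => [xyC|[z]].
  exists (perm_word y s^-1); last by rewrite -[LHS](actKV (perm_word_action N) s).
  have /code_autP sP := sC; rewrite mem_code_coset -sP perm_word_add.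
  by rewrite (actKV (perm_word_action N) s).
have /code_autP sP := sC.
by rewrite mem_code_coset => xzC ->; rewrite -perm_word_add sP.
Qed.

(** Automorphisms are isometries preserving the code. This bounds the number of orbits from below by
    the number of distances that occur. *)
Lemma coset_orbit_dist C x y :
  coset_orbit C x = coset_orbit C y -> dist_code x C = dist_code y C.
Proof.
move=> exy.
have /orbitP[s sC e] : code_coset C x \in coset_orbit C y.
  by rewrite -exy orbit_refl.
have : perm_word y s \in code_coset C x.
  by rewrite -e; apply: imset_f; rewrite mem_code_coset F2_mxaddrr mem0v.
rewrite mem_code_coset => /(dist_code_coset x) <-.
by rewrite F2_mxaddKr dist_code_perm.
Qed.

(** Flip a coordinate in which [x] differs from a nearest codeword. *)
Lemma dist_code_descent C x l :
  dist_code x C = l.+1 -> exists y, dist_code y C = l.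
Proof.
move=> dx; have [c cC] := dist_code_attained C x; rewrite dx hdist_wt => wxc.
have /card_gt0P[k] : (0 < wt (x + c)%R)%N by rewrite -wxc.
rewrite inE => xck; exists (x + unit_word k); apply/eqP.
have := dist_code_lipschitz C x k; rewrite dx ltnS eqn_leq => ->.
rewrite andbT; apply/dist_code_leP; exists c => //.
by rewrite hdist_wt addrAC wt_add_unit (negPf xck) -wxc.
Qed.

Lemma dist_code_onto C l :
  (l <= covering_radius C)%N -> exists x, dist_code x C = l.
Proof.
have [x xmax] : exists x, covering_radius C = dist_code x C.
  have [|x _ e] := @eq_bigmax_cond _ predT (fun x : 'rV['F_2]_N => dist_code x C); last by exists x.
  by apply/card_gt0P; exists 0.
move=> le_l; have: exists x, dist_code x C = covering_radius C by exists x.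
rewrite -(subnK le_l); elim: (_ - _)%N => // j IHj [y].
by rewrite addSn => /dist_code_descent.
Qed.

(** All rho + 1 distances occur and each orbit has a single one, so one word per distance gives a
    full list of orbit representatives. Complete transitivity is thereby reduced to finding enough
    automorphisms. *)
Lemma completely_transitive_by_dist C :
    (forall x y, dist_code x C = dist_code y C -> coset_orbit C x = coset_orbit C y) ->
  completely_transitive C.
Proof.
move=> orbC; pose rho := (covering_radius C).
have rP (l : 'I_rho.+1) : exists x, dist_code x C == l.
  by have [x <-] := @dist_code_onto C l (ltn_ord l); exists x.
pose r l := xchoose (rP l).
have rE l : dist_code (r l) C = l by apply/eqP/(xchooseP (rP l)).
have r_inj : injective (fun l => coset_orbit C (r l)).
  by move=> i j /coset_orbit_dist; rewrite !rE => /val_inj.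
rewrite /completely_transitive -/rho -[rho.+1]card_ord -[RHS](card_imset _ r_inj).
apply: eq_card => A; apply/imsetP/imsetP => -[x _ ->]; last by exists (r x).
have ltx : (dist_code x C < rho.+1)%N.
  by rewrite ltnS; apply: leq_bigmax_cond.
by exists (Ordinal ltx) => //; apply: orbC; rewrite rE.
Qed.

End Distance.

(** * Syndromes and words of weight two, for arbitrary [f] *)

Section Syndromes.
Variables (m N : nat) (h : 'I_N -> 'rV['F_2]_m) (f : 'rV['F_2]_m -> 'F_2).
Implicit Types (x y : 'rV['F_2]_N) (u v w s : 'rV['F_2]_m) (a t : 'F_2).

Local Notation synd := ('F_2 * 'rV['F_2]_m * 'F_2)%type.
Implicit Types sg : synd.

Definition column v : synd := (1, v, f v).

Definition syndrome x : synd :=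
  (\sum_i x 0 i, \sum_i x 0 i *: h i, \sum_i x 0 i * f (h i)).

Lemma syndromeD x y : syndrome (x + y) = syndrome x + syndrome y.
Proof.
apply/eqP; rewrite !xpair_eqE /= -!big_split /=; apply/andP; split; first apply/andP; try split.
- by apply/eqP; apply: eq_bigr => i _; rewrite mxE.
- by apply/eqP; apply: eq_bigr => i _; rewrite mxE scalerDl.
- by apply/eqP; apply: eq_bigr => i _; rewrite mxE mulrDl.
Qed.

Lemma syndrome_unit k : syndrome (delta_mx 0 k) = column (h k).
Proof.
have [e1 e0] : (delta_mx 0 k : 'rV['F_2]_N) 0 k = 1 /\
    forall i, i != k -> (delta_mx 0 k : 'rV['F_2]_N) 0 i = 0.
  by split=> [|i /negPf ik]; rewrite mxE ?ik ?eqxx.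
congr (_, _, _); rewrite (bigD1 k) //= big1 ?addr0 => [|i /e0 ->].
- by rewrite e1.
- by [].
- by rewrite e1 scale1r.
- by rewrite scale0r.
- by rewrite e1 mul1r.
- by rewrite mul0r.
Qed.

Lemma syndrome_add_unit x k :
  syndrome (x + delta_mx 0 k) = syndrome x + column (h k).
Proof. by rewrite syndromeD syndrome_unit. Qed.

Lemma syndrome_perm x (p : 'S_N) :
  syndrome (perm_word x p) =
    (\sum_i x 0 i, \sum_i x 0 i *: h (p i), \sum_i x 0 i * f (h (p i))).
Proof.
by congr (_, _, _); rewrite (reindex_inj (@perm_inj _ p)); apply: eq_bigr => i _; rewrite mxE permK.
Qed.

Lemma synd_addrr sg : sg + sg = 0.
Proof.
by case: sg => [[a s] t]; congr (_, _, _); rewrite /= ?F2_addrr ?F2_mxaddrr.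
Qed.

Definition polar u v : 'F_2 := f (u + v) + f u + f v.

Lemma polarC u v : polar u v = polar v u.
Proof. by rewrite /polar addrAC [u + v]addrC. Qed.

Lemma quad_add u v : f (u + v) = f u + f v + polar u v.
Proof.
rewrite /polar; case: (F2P (f (u + v))) => ->; case: (F2P (f u)) => ->;
by case: (F2P (f v)) => ->; apply/eqP.
Qed.

Variable C : {vspace 'rV['F_2]_N}.
Hypothesis h_bij : bijective h.
Hypothesis memC : forall x, (x \in C) = (syndrome x == 0).

Lemma card_h_preim (P : pred 'rV['F_2]_m) : #|[set k | P (h k)]| = #|[set v | P v]|.
Proof.
have [h' hK h'K] := h_bij; rewrite -(card_imset _ (can_inj hK)).
apply: eq_card => v; rewrite inE; apply/imsetP/idP => [[k]|Pv].
  by rewrite inE => Pk ->.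
by exists (h' v); rewrite ?inE h'K.
Qed.

Lemma coset_orbit_syndrome x y :
  syndrome x = syndrome y -> coset_orbit C x = coset_orbit C y.
Proof.
move=> exy; rewrite /coset_orbit; congr orbit; apply/code_coset_eqP.
by rewrite memC syndromeD exy synd_addrr.
Qed.

(** Coordinates are labelled bijectively by vectors, so translations and transvections of F_2^m
    become coordinate permutations. *)
Lemma perm_of_map (T : 'rV['F_2]_m -> 'rV['F_2]_m) :
  injective T -> exists p : 'S_N, forall i, h (p i) = T (h i).
Proof.
move=> T_inj; have [h' hK h'K] := h_bij.
have inj : injective (fun i => h' (T (h i))).
  by move=> i j /(can_inj h'K)/T_inj/(can_inj hK).
by exists (perm inj) => i; rewrite permE h'K.
Qed.

(** The syndrome of the pair has first entry 0 and nonzero middle entry, whereas distance 1 requires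
    a column, with first entry 1, and distance 0 requires the zero syndrome. *)
Lemma dist_code_pair (k l : 'I_N) :
  k != l -> dist_code (delta_mx 0 k + delta_mx 0 l) C = 2%N.
Proof.
move=> kl; set x := _ + _.
have wx : wt x = 2%N by rewrite wt_add_unit wt_unit mxE [l == k]eq_sym (negPf kl) andbF eqxx.
apply/eqP; rewrite eqn_leq; apply/andP; split.
  by apply/dist_code_leP; exists 0; rewrite ?mem0v // hdist_wt addr0 wx.
rewrite ltnNge; apply/negP => /dist_code_leP[c]; rewrite memC hdist_wt => /eqP Sc.
have Sx : syndrome (x + c) = column (h k) + column (h l).
  by rewrite syndromeD Sc addr0 syndromeD !syndrome_unit.
rewrite leq_eqVlt => /orP[/wt_eq1P[j xj]|].
  by move: Sx; rewrite xj syndrome_unit => /(congr1 (fun sg => sg.1.1)).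
rewrite ltnS leqn0 wt_eq0 => /eqP xc0; move: Sx; rewrite xc0 => /(congr1 (fun sg => sg.1.2)).
have -> : (syndrome 0).1.2 = 0 by rewrite /= big1 // => i _; rewrite mxE scale0r.
move=> /esym/eqP; rewrite /= F2_mxaddr_eq0 (bij_eq h_bij).
by rewrite (negPf kl).
Qed.

(** A single flip must cancel the syndrome, which is then a column named by its middle entry. The
    first entry 1 rules out codewords. *)
Lemma dist_code_eq1 y : (syndrome y).1.1 = 1 ->
  (dist_code y C == 1%N) = (syndrome y == column (syndrome y).1.2).
Proof.
move=> Sy1; have [h' hK h'K] := h_bij; apply/eqP/eqP => [dy|Sy].
  have [c] := dist_code_attained C y; rewrite dy memC => /eqP Sc /esym/eqP/hdist_eq1P[k yk].
  have: syndrome c = 0 by [].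
  rewrite yk syndrome_add_unit => /eqP; rewrite addr_eq0 => /eqP Sy.
  suff -> : syndrome y = column (h k) by [].
  by apply/eqP; rewrite Sy eq_sym -addr_eq0 synd_addrr.
apply/eqP; rewrite eqn_leq; apply/andP; split.
  apply/dist_code_leP; exists (y + delta_mx 0 (h' (syndrome y).1.2)).
    by rewrite memC syndrome_add_unit h'K -Sy synd_addrr.
  by rewrite hdist_wt F2_mxaddKr wt_unit.
rewrite lt0n; apply/eqP => dy0.
have [c] := dist_code_attained C y; rewrite dy0 memC hdist_wt => cC /esym/eqP.
rewrite wt_eq0 F2_mxaddr_eq0 => /eqP yc; move: cC; rewrite -yc => /eqP Sy0.
by move: Sy1; rewrite Sy0.
Qed.

(** Flipping coordinate [j] gives first entry 1, hence distance 1 exactly when the last entry is [f]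
    of the middle one; [w] stands for [h j]. *)
Lemma card_lower_nbrs_pair (k l : 'I_N) : k != l ->
  #|lower_nbrs C (delta_mx 0 k + delta_mx 0 l)| =
  #|[set w | f (h k + h l + w) + f w == f (h k) + f (h l)]|.
Proof.
move=> kl; rewrite /lower_nbrs; set x := _ + _.
rewrite (card_neighbors x (fun y => (dist_code y C).+1 == dist_code x C)).
rewrite (dist_code_pair kl) -[RHS]card_h_preim; apply: eq_card => j; rewrite !inE eqSS.
have Sy : syndrome (x + delta_mx 0 j) =
    (1 + 1 + 1, h k + h l + h j, f (h k) + f (h l) + f (h j)).
  by rewrite !syndromeD !syndrome_unit.
have y1 : 1 + 1 + 1 = 1 :> 'F_2 by apply/eqP.
rewrite dist_code_eq1 Sy ?y1 // !xpair_eqE !eqxx /= eq_sym.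
by rewrite -[RHS]F2_addr_eq0 -[LHS]F2_addr_eq0 [in RHS]addrAC addrA addrAC.
Qed.

(** For additive [f] the last check follows from the other [1 + m]. This serves to rule out weight
    classes of equal parity. *)
Lemma dim_additive : (forall u v, f (u + v) = f u + f v) -> (N <= \dim C + (1 + m))%N.
Proof.
move=> fD; pose A := row_mx (const_mx 1) (\matrix_i h i) : 'M['F_2]_(N, 1 + m).
pose phi : 'Hom('rV['F_2]_N, 'rV['F_2]_(1 + m)) := linfun (mulmxr A).
have kerC : (lker phi <= C)%VS.
  apply/subvP=> x; rewrite memv_ker lfunE /= mul_mx_row -row_mx0.
  move=> /eqP/eq_row_mx[/rowP/(_ 0) x1 x2]; rewrite memC.
  have {}x1 : \sum_i x 0 i = 0.
    by move: x1; rewrite !mxE; under eq_bigr do rewrite mxE mulr1.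
  have {}x2 : \sum_i x 0 i *: h i = 0.
    by move: x2; rewrite mulmx_sum_row; under eq_bigr do rewrite rowK.
  suff x3 : \sum_i x 0 i * f (h i) = 0 by rewrite /syndrome x1 x2 x3.
  have f00 : f 0 = 0 by apply: (addrI (f 0)); rewrite -fD !addr0.
  rewrite -[RHS]f00 -x2 (big_morph f fD f00); apply: eq_bigr => i _.
  by case: (F2P (x 0 i)) => ->; rewrite ?mul0r ?mul1r ?scale0r ?scale1r.
have := limg_ker_dim phi fullv; rewrite capfv dimvf.
have -> : dim 'rV['F_2]_N = N by rewrite /dim /= mul1n.
move=> dimN; rewrite -[leqLHS]dimN; apply: leq_add; first exact: dimvS.
by apply: leq_trans (dimvS (subvf _)) _; rewrite dimvf /dim /= mul1n.
Qed.

(* The distance to the code of a word with the given syndrome, when f is a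
   quadratic bent function. *)
Definition syndrome_dist sg : nat :=
  let: (a, s, t) := sg in
  (if a == 0%R then if s != 0%R then 2 else if t == 0%R then 0 else 4
   else if t == f s then 1 else 3)%N.

(** * Quadratic forms with nondegenerate polar form *)

Hypothesis polarDl : forall u v w, polar (u + v) w = polar u w + polar v w.
Hypothesis polar_nondeg : forall u, u != 0 -> exists v, polar u v = 1.
Hypothesis m_gt0 : (0 < m)%N.

Lemma exists_nonzero : exists u : 'rV['F_2]_m, u != 0.
Proof.
exists (const_mx 1); apply/eqP=> /rowP/(_ (Ordinal m_gt0)).
by rewrite !mxE.
Qed.

Lemma polarDr u v w : polar u (v + w) = polar u v + polar u w.
Proof. by rewrite ![polar u _]polarC polarDl. Qed.

Lemma polar0l u : polar 0 u = 0.
Proof. by apply: (addrI (polar 0 u)); rewrite -polarDl !addr0. Qed.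

Lemma polarZl a u v : polar (a *: u) v = a * polar u v.
Proof. by case: (F2P a) => ->; rewrite ?scale0r ?scale1r ?mul0r ?mul1r ?polar0l. Qed.

Lemma polarZr a u v : polar u (a *: v) = a * polar u v.
Proof. by rewrite polarC polarZl polarC. Qed.

Lemma polar_sumZl (I : finType) (c : I -> 'F_2) (g : I -> 'rV['F_2]_m) w :
  polar (\sum_i c i *: g i) w = \sum_i c i * polar (g i) w.
Proof.
rewrite (big_morph (polar^~ w) (id1 := 0) (op1 := +%R)) //; last exact: polar0l.
by apply: eq_bigr => i _; rewrite polarZl.
Qed.

Lemma quad0 : f 0 = 0.
Proof. by have := polar0l 0; rewrite /polar addr0 F2_addrr add0r. Qed.

Lemma polarvv u : polar u u = 0.
Proof. by rewrite /polar F2_mxaddrr quad0 add0r F2_addrr. Qed.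

(** Translation by [w] exchanges the two level sets of [polar u], so each is half of the space. *)
Lemma card_polar_eq u w t :
  polar u w = 1 -> (#|[set v | polar u v == t]|.*2 = 2 ^ m)%N.
Proof.
move=> uw.
have <- : #|{: 'rV['F_2]_m}| = (2 ^ m)%N by rewrite card_mx card_Fp ?mul1n.
rewrite -cardsT -(cardsID [set v | polar u v == t] setT) setTI -addnn; congr addn.
rewrite -(card_imset _ (@addrI _ w)); apply: eq_card => v; rewrite !inE andbT.
apply/imsetP/idP => [[v']|uv].
  rewrite inE => /eqP uv' ->; rewrite polarDr uw uv'.
  by case: (F2P t) => ->.
exists (w + v); last by rewrite F2_mxaddKr.
rewrite inE polarDr uw.
by case: (F2P t) uv => ->; case: (F2P (polar u v)) => ->.
Qed.

(** * Distances and intersection numbers in the bent case *)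

Lemma add_column a s t v : (a, s, t) + column v = (a + 1, s + v, t + f v).
Proof. by []. Qed.

Lemma syndrome_dist_step0 t v :
  syndrome_dist ((0, 0, t) + column v) = if t == 0 then 1%N else 3%N.
Proof.
by rewrite add_column !add0r /= -subr_eq0 addrK.
Qed.

(** The new syndrome is a column when [t + f v = f (s + v)]; expanding by the polar form cancels
    [f v]. *)
Lemma syndrome_dist_step2 s t v : s != 0 ->
  syndrome_dist ((0, s, t) + column v) = if polar s v == t + f s then 1%N else 3%N.
Proof.
move=> _; rewrite add_column add0r /= quad_add.
by case: (F2P t) => ->; case: (F2P (f s)) => ->; case: (F2P (f v)) => ->;
   case: (F2P (polar s v)) => ->.
Qed.

Lemma syndrome_dist_step1 s t v :
  syndrome_dist ((1, s, t) + column v) =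
    if v == s then if t == f s then 0%N else 4%N else 2%N.
Proof.
rewrite add_column F2_addrr /= F2_mxaddr_eq0 eq_sym.
by case: eqVneq => //= ->; rewrite F2_addr_eq0.
Qed.

(** The cases group the syndromes with distance in {0, 4}, equal to 2, and in {1, 3}. *)
Lemma syndrome_cases (P : synd -> Prop) :
    (forall t, P (0, 0, t)) -> (forall s t, s != 0 -> P (0, s, t)) ->
    (forall s t, P (1, s, t)) ->
  forall sg, P sg.
Proof.
move=> P0 P2 P1 [[a s] t]; case: (F2P a) => -> //.
by have [->|] := eqVneq s 0; [apply: P0 | apply: P2].
Qed.

Lemma syndrome_dist_lipschitz sg v :
  (syndrome_dist sg <= (syndrome_dist (sg + column v)%R).+1)%N.
Proof.
elim/syndrome_cases: sg => [t|s t s0|s t].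
- by rewrite syndrome_dist_step0 /= eqxx; case: (F2P t) => ->.
- by rewrite syndrome_dist_step2 //= s0; case: ifP.
- by rewrite syndrome_dist_step1 /=; do 2?case: ifP.
Qed.

Lemma syndrome_dist_descent sg : (0 < syndrome_dist sg)%N ->
  exists v, syndrome_dist sg = (syndrome_dist (sg + column v)).+1.
Proof.
elim/syndrome_cases: sg => [t H|s t s0 _|s t _].
- by exists 0; move: H; rewrite syndrome_dist_step0 /= eqxx; case: eqP.
- have [w sw] := polar_nondeg s0.
  (* This multiple of [w] solves [polar s v = t + f s]. *)
  exists ((t + f s) *: w).
  by rewrite syndrome_dist_step2 //= s0 polarZr sw mulr1 eqxx.
- have [ts|ts] := eqVneq t (f s).
    by exists s; rewrite syndrome_dist_step1 /= ts !eqxx.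
  have [u u0] := exists_nonzero; exists (s + u).
  have us : s + u != s by rewrite -subr_eq0 [s + u]addrC addrK.
  by rewrite syndrome_dist_step1 (negPf us) /= (negPf ts).
Qed.

Lemma card_set_const (b : bool) :
  #|[set v : 'rV['F_2]_m | b]| = if b then (2 ^ m)%N else 0%N.
Proof.
case: b; last by apply: eq_card0 => v; rewrite inE.
by rewrite cardsE card_mx card_Fp ?mul1n.
Qed.

Lemma card_neq s : #|[set v | v != s]| = (2 ^ m - 1)%N.
Proof. by rewrite cardsE cardC1 card_mx card_Fp ?mul1n ?subn1. Qed.

Lemma card_upper_step sg :
  #|[set v | syndrome_dist (sg + column v) == (syndrome_dist sg).+1]| =
  nth 0%N [:: (2 ^ m)%N; (2 ^ m - 1)%N; (2 ^ m %/ 2)%N; 1%N] (syndrome_dist sg).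
Proof.
elim/syndrome_cases: sg => [t|s t s0|s t].
- transitivity #|[set v : 'rV['F_2]_m | t == 0]|.
    apply: eq_card => v; rewrite !inE syndrome_dist_step0 /= eqxx.
    by case: (F2P t) => ->.
  by rewrite /= eqxx card_set_const; case: (F2P t) => ->.
- have [w sw] := polar_nondeg s0.
  rewrite [syndrome_dist (0, s, t)]/= s0 [nth _ _ _]/=.
  (* Distance 3 means that [polar s v] differs from [t + f s], that is, equals [t + f s + 1]. *)
  rewrite -(card_polar_eq (t + f s + 1) sw) -muln2 mulnK //.
  apply: eq_card => v; rewrite !inE syndrome_dist_step2 //.
  by case: (F2P (t + f s)) => ->; case: (F2P (polar s v)) => ->.
- rewrite [syndrome_dist (1, s, t)]/=; case: eqVneq => ts; rewrite [nth _ _ _]/=.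
    rewrite -(card_neq s); apply: eq_card => v.
    by rewrite !inE syndrome_dist_step1 ts eqxx; case: (v == s).
  rewrite -[RHS](cards1 s); apply: eq_card => v.
  by rewrite !inE syndrome_dist_step1 (negPf ts); case: (v == s).
Qed.

Lemma card_lower_step sg :
  #|[set v | (syndrome_dist (sg + column v)).+1 == syndrome_dist sg]| =
  nth 0%N [:: 0%N; 1%N; (2 ^ m %/ 2)%N; (2 ^ m - 1)%N; (2 ^ m)%N] (syndrome_dist sg).
Proof.
elim/syndrome_cases: sg => [t|s t s0|s t].
- transitivity #|[set v : 'rV['F_2]_m | t != 0]|.
    apply: eq_card => v; rewrite !inE syndrome_dist_step0 /= eqxx.
    by case: (F2P t) => ->.
  by rewrite /= eqxx card_set_const; case: (F2P t) => ->.
- have [w sw] := polar_nondeg s0.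
  rewrite [syndrome_dist (0, s, t)]/= s0 [nth _ _ _]/=.
  rewrite -(card_polar_eq (t + f s) sw) -muln2 mulnK //.
  apply: eq_card => v; rewrite !inE syndrome_dist_step2 //.
  by case: (_ == t + f s).
- rewrite [syndrome_dist (1, s, t)]/=; case: eqVneq => ts; rewrite [nth _ _ _]/=.
    rewrite -[RHS](cards1 s); apply: eq_card => v.
    by rewrite !inE syndrome_dist_step1 ts eqxx; case: (v == s).
  rewrite -(card_neq s); apply: eq_card => v.
  by rewrite !inE syndrome_dist_step1 (negPf ts); case: (v == s).
Qed.

Lemma dist_code_syndrome x : dist_code x C = syndrome_dist (syndrome x).
Proof.
have [h' hK h'K] := h_bij.
apply: (dist_codeE (d := fun x => syndrome_dist (syndrome x))) => {}x.
- rewrite memC; elim/syndrome_cases: (syndrome x) => [t|s t s0|s t] /=.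
  + by rewrite eqxx; case: (F2P t) => ->; rewrite // !xpair_eqE !eqxx.
  + by rewrite s0 !xpair_eqE (negPf s0).
  + by case: ifP; rewrite !xpair_eqE.
- by move=> k; rewrite syndrome_add_unit syndrome_dist_lipschitz.
- move=> /syndrome_dist_descent[v ->]; exists (h' v).
  by rewrite syndrome_add_unit h'K.
Qed.

Lemma completely_regular_bent :
  completely_regular_with C
    (nth 0%N [:: (2 ^ m)%N; (2 ^ m - 1)%N; (2 ^ m %/ 2)%N; 1%N])
    (nth 0%N [:: 0%N; 1%N; (2 ^ m %/ 2)%N; (2 ^ m - 1)%N; (2 ^ m)%N]).
Proof.
move=> x; rewrite /upper_nbrs /lower_nbrs.
rewrite (card_neighbors x (fun y => dist_code y C == (dist_code x C).+1)).
rewrite (card_neighbors x (fun y => (dist_code y C).+1 == dist_code x C)).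
rewrite !dist_code_syndrome -card_upper_step -card_lower_step -!card_h_preim.
by split; apply: eq_card => k; rewrite !inE dist_code_syndrome syndrome_add_unit.
Qed.

Lemma covering_radius_bent : covering_radius C = 4%N.
Proof.
have [h' hK h'K] := h_bij.
apply/eqP; rewrite eqn_leq; apply/andP; split.
  apply/bigmax_leqP => x _; rewrite dist_code_syndrome.
  by case: (syndrome x) => [[a s] t] /=; do ![case: ifP => _ //].
have [u u0] := exists_nonzero; have [v uv] := polar_nondeg u0.
pose e w : 'rV['F_2]_N := delta_mx 0 (h' w).
(* The four points sum to 0 and the values of [f] on them sum to [polar u v = 1], which gives the
   syndrome [(0, 0, 1)] of distance 4. *)
pose x := e 0 + e u + e v + e (u + v).
apply: leq_trans (leq_bigmax_cond _ (_ : predT x)) => //.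
suff -> : dist_code x C = 4%N by [].
rewrite dist_code_syndrome !syndromeD !syndrome_unit !h'K.
suff -> : column 0 + column u + column v + column (u + v) = (0, 0, 1).
  by rewrite /= !eqxx.
have -> : column 0 + column u + column v + column (u + v) =
    (1 + 1 + 1 + 1, 0 + u + v + (u + v), f 0 + f u + f v + f (u + v)) by [].
congr (_, _, _); first exact/eqP.
  by rewrite add0r F2_mxaddrr.
by rewrite quad0 add0r -uv /polar addrC addrA.
Qed.

(** * Complete transitivity in the bent case *)

Lemma coset_orbit_translate x a s t b : syndrome x = (a, s, t) ->
  exists2 y, coset_orbit C y = coset_orbit C x &
             syndrome y = (a, s + a *: b, t + a * f b + polar s b).
Proof.
have [p hp] := perm_of_map (@addIr _ b).
(* Translating by [b] changes [f] by the affine function [f b + polar v b] of [v], so the new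
   syndrome is linear in the old one. *)
have Sp z : syndrome (perm_word z p) =
    let: (a, s, t) := syndrome z in (a, s + a *: b, t + a * f b + polar s b).
  rewrite syndrome_perm /syndrome; congr (_, _, _).
    by rewrite scaler_suml -big_split; apply: eq_bigr => i _; rewrite hp scalerDr.
  rewrite polar_sumZl mulr_suml -!big_split; apply: eq_bigr => i _.
  by rewrite hp quad_add !mulrDr.
have pC : p \in code_aut C.
  apply: stable_code_aut => z; rewrite !memC Sp => /eqP -> /=.
  by rewrite scale0r mul0r polar0l !addr0.
by move=> Sx; exists (perm_word x p); rewrite ?coset_orbit_perm // Sp Sx.
Qed.

(** The transvection [T] is an involution since [polar u u = 0]. With [c = polar v u],
    [f (T v) = f v + c f u + c^2], and [c^2 = c], so [f] changes by a linear function. *)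
Lemma coset_orbit_transvect x a s t u : syndrome x = (a, s, t) ->
  exists2 y, coset_orbit C y = coset_orbit C x &
             syndrome y = (a, s + polar s u *: u, t + polar s u * (f u + 1)).
Proof.
pose T v := v + polar v u *: u.
have TK : involutive T.
  move=> v; rewrite /T polarDl polarZl polarvv mulr0 addr0 -addrA -scalerDl.
  by rewrite F2_addrr scale0r addr0.
have [p hp] := perm_of_map (can_inj TK).
have Sp z : syndrome (perm_word z p) =
    let: (a, s, t) := syndrome z in
    (a, s + polar s u *: u, t + polar s u * (f u + 1)).
  rewrite syndrome_perm /syndrome polar_sumZl; congr (_, _, _).
    rewrite scaler_suml -big_split; apply: eq_bigr => i _.
    by rewrite hp scalerDr scalerA.
  rewrite mulr_suml -!big_split; apply: eq_bigr => i _ /=.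
  rewrite hp /T quad_add polarZr -addrA -mulrA -mulrDr; congr (_ * (_ + _)).
  by case: (F2P (polar (h i) u)) => ->; rewrite ?scale0r ?scale1r ?quad0 ?mul0r ?addr0 ?mul1r.
have pC : p \in code_aut C.
  apply: stable_code_aut => z; rewrite !memC Sp => /eqP -> /=.
  by rewrite polar0l scale0r mul0r !addr0.
by move=> Sx; exists (perm_word x p); rewrite ?coset_orbit_perm // Sp Sx.
Qed.

(* The transvection along [s + s'] maps [s] to [s'] when [polar s s' = 1]. *)
Lemma coset_orbit_move x a s t s' : syndrome x = (a, s, t) -> polar s s' = 1 ->
  exists y t', coset_orbit C y = coset_orbit C x /\ syndrome y = (a, s', t').
Proof.
move=> Sx ss'; have [y yx] := coset_orbit_transvect (s + s') Sx.
rewrite polarDr polarvv add0r ss' scale1r F2_mxaddKr => Sy.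
by exists y; eexists; split; last exact: Sy.
Qed.

(** A vector space is not the union of two hyperplanes. The vector [w] is the halfway point when
    moving [s] to [s'] by transvections. *)
Lemma polar_common_nonorthogonal s s' : s != 0 -> s' != 0 ->
  exists w, polar s w = 1 /\ polar w s' = 1.
Proof.
move=> /polar_nondeg[v sv] /polar_nondeg[v' s'v'].
case: (F2P (polar s' v)) => s'v; last by exists v; rewrite [polar v _]polarC.
case: (F2P (polar s v')) => sv'; last by exists v'; rewrite [polar v' _]polarC.
by exists (v + v'); rewrite polarDr [polar (v + v') _]polarC polarDr sv sv' s'v s'v' addr0 add0r.
Qed.

Lemma completely_transitive_bent : completely_transitive C.
Proof.
apply: completely_transitive_by_dist => x y; rewrite !dist_code_syndrome.
case Sx: (syndrome x) => [[a s] t]; case Sy: (syndrome y) => [[a' s'] t'] dxy.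
(* The entry [a] is the parity of the distance. *)
have {dxy} [ea dxy] : a = a' /\ syndrome_dist (a, s, t) = syndrome_dist (a, s', t').
  move: dxy; case: (F2P a) => ->; case: (F2P a') => -> //=;
  by do ![case: ifP => _ //].
subst a'; case: (F2P a) => ea; subst a.
  have [s0|s0] := eqVneq s 0.
    apply: coset_orbit_syndrome; rewrite Sx Sy; move: dxy; rewrite /= s0 eqxx.
    have [->|//] := eqVneq s' 0; last by case: ifP.
    by case: (F2P t) => ->; case: (F2P t') => ->.
  have s'0 : s' != 0.
    by apply: contra_eqN dxy => /eqP ->; rewrite /= s0 eqxx; case: ifP.
  (* Two transvections move [s] to [s'] through [w]; a translation then corrects the last entry and,
     the first entry being 0, nothing else. *)
  have [w [sw ws']] := polar_common_nonorthogonal s0 s'0.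
  have [z1 [t1 [<- Sz1]]] := coset_orbit_move Sx sw.
  have [z2 [t2 [<- Sz2]]] := coset_orbit_move Sz1 ws'.
  have [v s'v] := polar_nondeg s'0.
  have [z3 <- Sz3] := coset_orbit_translate ((t2 + t') *: v) Sz2.
  apply: coset_orbit_syndrome; rewrite Sz3 Sy scale0r mul0r !addr0 polarZr s'v mulr1.
  by rewrite addrA F2_addrr add0r.
(* With first entry 1, translation brings the middle entry to 0 and the last to [t + f s], which the
   distance determines. *)
have [x1 <- Sx1] := coset_orbit_translate s Sx.
have [y1 <- Sy1] := coset_orbit_translate s' Sy.
apply: coset_orbit_syndrome; rewrite Sx1 Sy1 !scale1r !F2_mxaddrr !mul1r !polarvv !addr0.
congr (_, _, _); move: dxy => /=.
by case: (F2P t) => ->; case: (F2P t') => ->; case: (F2P (f s)) => ->;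
  case: (F2P (f s')) => -> // _; apply/eqP.
Qed.

End Syndromes.

(** * A wrong intersection number when 0 is a chosen class *)

Lemma card_lower_nbrs_punctured (m N : nat) (h : 'I_N -> 'rV['F_2]_m)
    (f q : 'rV['F_2]_m -> 'F_2) (C : {vspace 'rV['F_2]_N}) :
    (2 < m)%N -> bijective h -> (forall x, (x \in C) = (syndrome h f x == 0)) ->
    (forall u v w, polar q (u + v) w = polar q u w + polar q v w) ->
    (forall v, f v = q v + (v != 0)%:R) ->
  exists2 x, dist_code x C = 2%N & #|lower_nbrs C x| != (2 ^ m %/ 2)%N.
Proof.
move=> m_gt2 h_bij memC polarDl fE; have [h' hK h'K] := h_bij.
have [s s0] := exists_nonzero (ltnW (ltnW m_gt2)).
have ks : h' 0 != h' s by rewrite (can_eq h'K) eq_sym.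
exists (delta_mx 0 (h' 0) + delta_mx 0 (h' s)).
  by rewrite (dist_code_pair h_bij memC).
rewrite (card_lower_nbrs_pair h_bij memC) // !h'K add0r.
(* Away from [0] and [s] the indicators cancel on the left and one remains on the right, leaving
   [polar q s w = 1]. The points [0] and [s] are two extra solutions. *)
have -> : [set w | f (s + w) + f w == f 0 + f s]
    = [set w | polar q s w == 1] :|: [set 0; s].
  apply/setP=> w; rewrite !inE !fE eqxx (quad0 polarDl) s0 F2_mxaddr_eq0.
  have [->|w0] := eqVneq w 0.
    by rewrite !addr0 (quad0 polarDl) add0r s0 orbT addr0 eqxx.
  have [->|ws] := eqVneq w s.
    by rewrite F2_mxaddrr (quad0 polarDl) /= !add0r eqxx orbT.
  rewrite orbF quad_add.
  by case: (F2P (q s)) => ->; case: (F2P (q w)) => ->; case: (F2P (polar q s w)) => -> //=.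
have -> : #|[set w | polar q s w == 1] :|: [set 0; s]| = (#|[set w | polar q s w == 1%R]| + 2)%N.
  rewrite cardsU cards2 eq_sym s0.
  have -> : [set w | polar q s w == 1] :&: [set 0; s] = set0.
    apply/setP=> w; rewrite !inE; apply/negP => /andP[sw /orP[] /eqP w0]; move: sw.
      by rewrite w0 polarC (polar0l polarDl).
    by rewrite w0 (polarvv polarDl).
  by rewrite cards0 subn0.
(* If [polar q s] vanishes identically the count is 2, less than [2 ^ (m - 1)] because [m > 2];
   otherwise it is [2 ^ (m - 1) + 2]. *)
case: (set_0Vmem [set w | polar q s w == 1]) => [->|[w]].
  rewrite cards0 add0n -(subnKC m_gt2) !expnS.
  by rewrite mulKn //; have := expn_gt0 2 (m - 3); lia.
rewrite inE => /eqP /(card_polar_eq polarDl 1) <-.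
by rewrite -muln2 mulnK // -[X in _ != X]addn0 eqn_add2l.
Qed.

(** * Weight classes modulo four as a quadratic form *)

Section WeightModFour.
Variables (m : nat) (i1 i2 : 'I_4).
Implicit Types (x y z : 'rV['F_2]_m).

Definition weight_class (w : nat) : bool :=
  (w == i1 %[mod 4]) || (w == i2 %[mod 4]).

(** Modulo 4, [d] is [a + b - 2c], and [-2c = 2c] depends only on the parity of [c], so a finite
    check on residues suffices. The last term becomes the polar form. *)
Lemma weight_class_add (a b c d : nat) : i1 != i2 -> (d + c.*2 = a + b)%N ->
  weight_class d = weight_class a (+) weight_class b (+) weight_class 0
                   (+) (odd i1 (+) odd i2) && (odd a && odd b (+) odd c).
Proof.
move=> i12 e.
have {e} : d = a %% 4 + b %% 4 + (odd c).*2 %[mod 4].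
  by have := odd_double_half c; lia.
have odd4 k : odd (k %% 4) = odd k by rewrite odd_mod.
rewrite /weight_class => ->; rewrite -(odd4 a) -(odd4 b) -(modn_mod a) -(modn_mod b) mod0n.
have := ltn_pmod a (isT : 0 < 4)%N; have := ltn_pmod b (isT : 0 < 4)%N.
move: (a %% 4)%N (b %% 4)%N (odd c) => {}b {}a {}c.
case: i1 i12 => [k1 lt1]; case: i2 => [k2 lt2]; rewrite -val_eqE /=.
case: k1 lt1 => [|[|[|[|]]]] // _; case: k2 lt2 => [|[|[|[|]]]] // _ _;
by case: a => [|[|[|[|]]]] //; case: b => [|[|[|[|]]]] // _ _; case: c.
Qed.

Lemma wtD x y :
  (wt (x + y)%R + #|[set i | (x 0%R i != 0%R) && (y 0%R i != 0%R)]|.*2 = wt x + wt y)%N.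
Proof.
pose X := [set i | x 0 i != 0]; pose Y := [set i | y 0 i != 0].
have -> : [set i | (x 0%R i != 0%R) && (y 0%R i != 0%R)] = X :&: Y.
  by apply/setP=> i; rewrite !inE.
have -> : wt (x + y) = #|(X :\: Y) :|: (Y :\: X)|.
  apply: eq_card => i; rewrite !inE mxE.
  by case: (F2P (x 0 i)) => ->; case: (F2P (y 0 i)) => ->.
have disj : (X :\: Y) :&: (Y :\: X) = set0.
  by apply/setP=> i; rewrite !inE; case: (x 0 i == 0); case: (y 0 i == 0).
have := cardsID Y X; have := cardsID X Y; rewrite [Y :&: X]setIC cardsU disj cards0.
by rewrite -/(wt x) -/(wt y) /wt -/X -/Y; lia.
Qed.

Lemma sum_wt x : \sum_i x 0 i = (wt x)%:R.
Proof.
rewrite /wt -sum1_card natr_sum [RHS]big_mkcond /=; apply: eq_bigr => i _; rewrite inE.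
by case: (F2P (x 0 i)) => ->.
Qed.

Lemma sum_wt_mul x y :
  \sum_i x 0 i * y 0 i = #|[set i | (x 0 i != 0) && (y 0 i != 0)]|%:R.
Proof.
rewrite -sum1_card natr_sum [RHS]big_mkcond /=; apply: eq_bigr => i _; rewrite inE.
by case: (F2P (x 0 i)) => ->; case: (F2P (y 0 i)) => ->; rewrite ?mul0r ?mul1r.
Qed.

Lemma F2_natr k : k%:R = (odd k)%:R :> 'F_2.
Proof. by apply: val_inj; rewrite /= !val_Fp_nat // modn2; case: (odd k). Qed.

Lemma F2_addb (b c : bool) : (b (+) c)%:R = b%:R + c%:R :> 'F_2.
Proof. by case: b c => [] []; apply/eqP. Qed.

Lemma F2_andb (b c : bool) : (b && c)%:R = b%:R * c%:R :> 'F_2.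
Proof. by case: b c => [] []; apply/eqP. Qed.

(** Adding [weight_class 0] makes the form vanish at 0. *)
Definition weight_form x : 'F_2 := (weight_class (wt x) (+) weight_class 0)%:R.

Lemma polar_weight_form x y : i1 != i2 ->
  polar weight_form x y =
    (odd i1 (+) odd i2)%:R *
    ((\sum_i x 0 i) * (\sum_i y 0 i) + \sum_i x 0 i * y 0 i).
Proof.
move=> i12; rewrite !sum_wt sum_wt_mul !(F2_natr (wt _)) !(F2_natr #|_|).
rewrite -F2_andb -F2_addb -F2_andb /polar /weight_form (weight_class_add i12 (wtD x y)).
rewrite -!F2_addb; congr (nat_of_bool _)%:R.
by case: (weight_class (wt x)); case: (weight_class (wt y)); case: (weight_class 0);
  case: (_ && _).
Qed.

Lemma polar_weight_formDl x y z : i1 != i2 ->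
  polar weight_form (x + y) z = polar weight_form x z + polar weight_form y z.
Proof.
move=> i12; rewrite !polar_weight_form // -mulrDr addrACA -mulrDl -!big_split /=.
congr (_ * (_ * _ + _)); apply: eq_bigr => i _;
  by rewrite mxE ?mulrDl.
Qed.

(** If [x] is orthogonal to every unit vector, each coordinate equals the sum of all of them; that
    sum is then [m] times itself, which is 0 for even [m]. *)
Lemma polar_weight_form_nondeg x : ~~ odd m -> odd i1 (+) odd i2 ->
  x != 0 -> exists y, polar weight_form x y = 1.
Proof.
move=> m_even i12; have i12n : i1 != i2 by apply: contraTneq i12 => ->; rewrite addbb.
have [/existsP[y /eqP xy]|/existsPn xP] := boolP [exists y, polar weight_form x y == 1].
  by exists y.
case/eqP; apply/rowP => j.
have xj k : x 0 k = \sum_i x 0 i.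
  have e : \sum_i x 0 i * (delta_mx 0 k : 'rV['F_2]_m) 0 i = x 0 k.
    rewrite (bigD1 k) //= mxE !eqxx mulr1 big1 ?addr0 // => i /negPf ik.
    by rewrite mxE ik mulr0.
  have := xP (delta_mx 0 k); rewrite F2_neq1 polar_weight_form // i12 mul1r e.
  by rewrite (sum_wt (delta_mx 0 k)) wt_unit mulr1 addrC F2_addr_eq0 => /eqP.
rewrite mxE xj; under eq_bigr do rewrite xj.
by rewrite sumr_const card_ord -mulr_natr F2_natr (negPf m_even) mulr0.
Qed.

End WeightModFour.

(** * Columns of the extended parity check matrix *)

Section Columns.
Variables (m n : nat) (L : fieldExtType 'F_2) (alpha : L) (i1 i2 : 'I_4).
Hypothesis hn : n = (2 ^ m - 1)%N.
Hypothesis hL : \dim {:L} = m.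
Hypothesis halpha : n.-primitive_root alpha.

(** The degree of [alpha] over F_2 is at most [m], so every power is a polynomial in [alpha] of
    degree below [m]. Hence [coord] yields true coordinates. *)
Lemma power_basis_span j : alpha ^+ j \in <<power_basis alpha m>>%VS.
Proof.
have aj : alpha ^+ j \in <<1; alpha>>%VS by rewrite rpredX // memv_adjoin.
rewrite -(Fadjoin_poly_eq aj) horner_coef.
have size_le : (size (Fadjoin_poly 1 alpha (alpha ^+ j)) <= m)%N.
  apply: leq_trans (size_Fadjoin_poly _ _ _) _.
  have := dim_Fadjoin 1%AS alpha; rewrite dimv1 muln1 -hL => <-.
  exact: dimvS (subvf _).
apply: memv_suml => i _.
have /polyOverP/(_ i)/vlineP[c ->] := Fadjoin_polyOver 1 alpha (alpha ^+ j).
rewrite mulr_algl memvZ // memv_span //.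
by apply/tnthP; exists (Ordinal (leq_trans (ltn_ord i) size_le)); rewrite tnth_mktuple.
Qed.

Definition extended_column (i : 'I_(1 + n)) : 'rV['F_2]_m :=
  match split i with inl _ => 0 | inr j => (col j (hamming_mx alpha m n))^T end.

Lemma extended_column_lshift i : extended_column (lshift n i) = 0.
Proof. by rewrite /extended_column (unsplitK (inl i)). Qed.

Lemma extended_column_rshift j :
  extended_column (rshift 1 j) = (col j (hamming_mx alpha m n))^T.
Proof. by rewrite /extended_column (unsplitK (inr j)). Qed.

Lemma hamming_col_combination (j : 'I_n) :
  alpha ^+ j = \sum_i ((col j (hamming_mx alpha m n))^T : 'rV_m) 0 i *: alpha ^+ i.
Proof.
rewrite [LHS](coord_span (power_basis_span j)); apply: eq_bigr => i _.
by rewrite !mxE nth_mktuple.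
Qed.

Lemma hamming_col_neq0 j : (col j (hamming_mx alpha m n))^T != 0.
Proof.
apply/eqP=> col0; have := hamming_col_combination j.
rewrite col0 big1 => [/eqP|i _]; last by rewrite mxE scale0r.
apply/negP; rewrite expf_neq0 //; apply: contra_eqN (prim_expr_order halpha).
by move=> /eqP ->; rewrite expr0n eqn0Ngt (prim_order_gt0 halpha) eq_sym oner_eq0.
Qed.

(** Powers with exponents below the order [n] are distinct and nonzero, hence so are their
    coordinate vectors; with the zero vector at infinity, [1 + n = 2 ^ m] turns injectivity into
    bijectivity. *)
Lemma extended_column_bij : bijective extended_column.
Proof.
apply: inj_card_bij; last first.
  by rewrite card_mx card_Fp // mul1n card_ord hn subnKC ?expn_gt0.
move=> i j; rewrite -[i]splitK -[j]splitK.
case: (split i) => [i'|i']; case: (split j) => [j'|j'] /=.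
- by rewrite !ord1.
- rewrite extended_column_lshift extended_column_rshift => /esym/eqP.
  by rewrite (negPf (hamming_col_neq0 _)).
- rewrite extended_column_lshift extended_column_rshift => /eqP.
  by rewrite (negPf (hamming_col_neq0 _)).
rewrite !extended_column_rshift => e; congr rshift; apply: val_inj => /=.
have: alpha ^+ i' = alpha ^+ j' by rewrite !hamming_col_combination e.
by move/eqP; rewrite (eq_prim_root_expr halpha) !modn_small // => /eqP.
Qed.

(** The weight row has no entry at infinity, so the value at the zero vector is 0 whatever the class
    of weight 0. *)
Definition column_class (v : 'rV['F_2]_m) : 'F_2 :=
  (if v == 0 then false else weight_class i1 i2 (wt v))%:R.

Lemma mem_extension_syndrome (z : 'rV['F_2]_(1 + n)) :
  (z \in extension (code_i1i2 alpha m n i1 i2)) =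
  (syndrome extended_column column_class z == 0).
Proof.
set H := hamming_mx alpha m n; rewrite -[z]hsubmxK.
move: (lsubmx z) (rsubmx z) => a x.
have -> : syndrome extended_column column_class (row_mx a x) =
    (a 0 0 + \sum_j x 0 j, \sum_j x 0 j *: (col j H)^T,
     \sum_j x 0 j * weight_row alpha m n i1 i2 0 j).
  rewrite /syndrome !big_split_ord !big_ord1 /= row_mxEl extended_column_lshift.
  rewrite scaler0 /column_class eqxx mulr0 !add0r.
  congr (_ + _, _, _); apply: eq_bigr => j _; rewrite row_mxEr ?extended_column_rshift //.
  by rewrite (negPf (hamming_col_neq0 j)) [in RHS]mxE.
have codeE : (x \in code_i1i2 alpha m n i1 i2) =
    (\sum_j x 0 j *: (col j H)^T == 0) &&
    (\sum_j x 0 j * weight_row alpha m n i1 i2 0 j == 0).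
  rewrite /code_i1i2 mem_parity_check_code mul_col_mx col_mx_eq0; congr andb.
    rewrite -(inj_eq (@trmx_inj _ _ _)) trmx_mul trmxK trmx0 mulmx_sum_row.
    by under eq_bigr do rewrite -tr_col.
  have -> : \sum_j x 0 j * weight_row alpha m n i1 i2 0 j
      = (weight_row alpha m n i1 i2 *m x^T) 0 0.
    by rewrite [RHS]mxE; apply: eq_bigr => j _; rewrite [x^T _ _]mxE mulrC.
  apply/eqP/eqP => [->|e]; first by rewrite mxE.
  by apply/matrixP=> i j; rewrite !ord1 e mxE.
rewrite !xpair_eqE /= -andbA -codeE F2_addr_eq0; apply/mem_extensionP/andP.
  by case=> y yC /eq_row_mx[-> ->]; rewrite mxE eqxx.
case=> /eqP ax xC; exists x => //; congr row_mx.
by apply/matrixP=> i j; rewrite !ord1 ax mxE eqxx.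
Qed.

End Columns.

(** * The two implications, according to the class of weight 0 *)

Theorem theorem2p7 (m n : nat) (hm4 : (4 <= m)%N) (hm : ~~ odd m)
  (hn : n = (2 ^ m - 1)%N)
  (L : fieldExtType 'F_2) (hL : \dim {:L} = m)
  (alpha : L) (halpha : n.-primitive_root alpha)
  (i1 i2 : 'I_4) (hi : i1 != i2)
  (hC : code_params (extension (code_i1i2 alpha m n i1 i2)) (n - m - 1)%N 4%N) :
  [/\ completely_transitive (extension (code_i1i2 alpha m n i1 i2)),
      covering_radius (extension (code_i1i2 alpha m n i1 i2)) = 4%N
    & is_intersection_array (extension (code_i1i2 alpha m n i1 i2))
        [:: (n + 1)%N; n; ((n + 1) %/ 2)%N; 1%N]
        [:: 1%N; ((n + 1) %/ 2)%N; n; (n + 1)%N]]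
  <-> ord0 \notin [set i1; i2].
Proof.
have n1 : (n + 1 = 2 ^ m)%N by rewrite hn subnK ?expn_gt0.
have h_bij := extended_column_bij hn hL halpha.
have memC := @mem_extension_syndrome m n L alpha i1 i2 hL halpha.
have polarDl u v w := @polar_weight_formDl m i1 i2 u v w hi.
have class0 : weight_class i1 i2 0 = (ord0 \in [set i1; i2]).
  by rewrite !inE /weight_class !modn_small.
split=> [[_ rho4 [b [c [breg _]]]]|].
  (* The array prescribes [c_2 = 2 ^ (m - 1)], which a word of weight two violates. *)
  rewrite rho4 => -[_ c2 _ _]; apply/negP => i0.
  have fE (v : 'rV['F_2]_m) : column_class i1 i2 v = weight_form i1 i2 v + (v != 0)%:R.
    rewrite /column_class /weight_form class0 i0 -F2_addb; congr (nat_of_bool _)%:R.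
    case: eqP => [->|_] /=; last by rewrite addbT addbT negbK.
    by rewrite wt0 class0 i0.
  have [x dx] := card_lower_nbrs_punctured (ltnW hm4) h_bij memC polarDl fE.
  by have [_ ->] := breg x; rewrite dx -c2 n1 eqxx.
move=> i0; have fE : column_class i1 i2 =1 @weight_form m i1 i2.
  move=> v; rewrite /column_class /weight_form class0 (negPf i0) addbF.
  by case: eqP => // ->; rewrite wt0 class0 (negPf i0).
have {}memC z : (z \in extension (code_i1i2 alpha m n i1 i2)) =
    (syndrome (extended_column m alpha) (@weight_form m i1 i2) z == 0).
  by rewrite memC /syndrome; under [X in (_, X) == _]eq_bigr do rewrite fE.
(* With equal parities the form is additive and the dimension is at least [n - m], against the
   assumed [n - m - 1]. *)
have odd12 : odd i1 (+) odd i2.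
  apply: contraT => /negPf odd12; have [dimC _] := hC.
  have fD (u v : 'rV['F_2]_m) :
      weight_form i1 i2 (u + v) = weight_form i1 i2 u + weight_form i1 i2 v.
    by rewrite quad_add polar_weight_form // odd12 mul0r addr0.
  have := dim_additive memC fD; rewrite dimC.
  (* Ensures [m < n], so that the subtraction in [n - m - 1] is not truncated. *)
  have : (2 ^ m = 2 * 2 ^ m.-1)%N by rewrite -expnS prednK // (leq_trans _ hm4).
  by have := ltn_expl m.-1 (isT : 1 < 2)%N; lia.
have nondeg u := @polar_weight_form_nondeg m i1 i2 u hm odd12.
have m_gt0 : (0 < m)%N by apply: leq_trans hm4.
have rho4 := covering_radius_bent h_bij memC polarDl nondeg m_gt0.
split=> //; first exact: (completely_transitive_bent h_bij memC polarDl nondeg m_gt0).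
eexists; eexists; split; first exact: (completely_regular_bent h_bij memC polarDl nondeg m_gt0).
  by rewrite rho4 /= n1 hn.
by rewrite rho4 /= n1 hn.
Qed.
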